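(* For every integer $k\ge2$ there is a constant $C_k>0$ such that for every $\varepsilon\in(0,1]$, every finite field $\mathbb{F}$ and every $k$-tensor $T$ over $\mathbb{F}$ with $|\mathbb{F}|\ge C_k(\mathrm{AR}(T)+1)^{k-2}/\varepsilon$, there is an LR-stable point $\mathbf{p}$ for $T$ with $$\|\mathrm{LR}_{\mathbf{p}}(T)\|\le(2^{k-1}-1+\varepsilon)\,\mathrm{AR}(T).$$
   Context: Tensors: a $k$-tensor over $\mathbb{F}$ is a multilinear map $(\mathbb{F}^n)^k\to\mathbb{F}$. With $d=k-1$ and $V=\mathbb{F}^n$, it is identified with a $d$-linear map $T\colon V^d\to V$ (the $d$-linear map $T$ corresponds to the $k$-tensor $(x_1,\ldots,x_{d+1})\mapsto T(x_1,\ldots,x_d)\cdot x_{d+1}$, with $\cdot$ the standard bilinear form). In this language the analytic rank is $\mathrm{AR}(T)=-\log_{|\mathbb{F}|}\left(|\{\mathbf{x}\in V^d: T(\mathbf{x})=0\}|/|V|^d\right)$. Local rank: for $\mathbf{x},\mathbf{p}\in V^d$ and $0\le i\le d$ let $\mathbf{p}\circ_i\mathbf{x}=(p_1,\ldots,p_i,x_{i+1},\ldots,x_d)$. For $i\in\{1,\ldots,d\}$ let $T[\mathbf{x}]_i\colon V\to V$ be the linear map $v\mapsto T(x_1,\ldots,x_{i-1},v,x_{i+1},\ldots,x_d)$. Write $\mathbf{p}\dashv_T\mathbf{x}$ if $T(\mathbf{p}\circ_i\mathbf{x})=0$ for all $1\le i\le d-1$. Let $\prec$ be the colexicographic order on $\mathbb{N}^d$: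 $\mathbf{a}\prec\mathbf{b}$ iff there is $i$ with $a_i<b_i$ and $a_j=b_j$ for all $j>i$. The local rank of $T$ at $\mathbf{p}\in V^d$ is the tuple $$\mathrm{LR}_{\mathbf{p}}(T)=\max\nolimits^{\prec}_{\mathbf{x}\in V^d:\ \mathbf{p}\dashv_T\mathbf{x}}\left(\mathrm{rank}\,T[\mathbf{p}\circ_1\mathbf{x}]_1,\ldots,\mathrm{rank}\,T[\mathbf{p}\circ_d\mathbf{x}]_d\right)\in\mathbb{N}^d,$$ the maximum being with respect to $\prec$. The algebraic local rank $\overline{\mathrm{LR}}_{\mathbf{p}}(T)$ is the local rank at $\mathbf{p}$ of $T$ viewed as a tensor over the algebraic closure $\overline{\mathbb{F}}$ (so $\mathbf{x}$ ranges over $(V\otimes\overline{\mathbb{F}})^d$). A point $\mathbf{p}\in V^d$ is LR-stable for $T$ if $\mathrm{LR}_{\mathbf{p}}(T)=\overline{\mathrm{LR}}_{\mathbf{p}}(T)$. For $\mathbf{r}\in\mathbb{N}^d$, $\|\mathbf{r}\|=\sum_{i=1}^d2^{d-i}r_i$. *)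

(* Defs.v *)
From HB Require Import structures.
From mathcomp Require Import all_boot all_order all_algebra all_field.
From mathcomp Require Import boolp classical_sets reals exp.

Set Implicit Arguments.
Unset Strict Implicit.
Unset Printing Implicit Defensive.

Import Order.TTheory GRing.Theory Num.Theory.
Local Open Scope ring_scope.

Definition subst_at (d : nat) (V : Type) (x : {ffun 'I_d -> V}) (i : 'I_d)
    (v : V) : {ffun 'I_d -> V} :=
  [ffun j => if j == i then v else x j].

Definition multilinear (F : fieldType) (n k : nat)
    (t : {ffun 'I_k -> 'rV[F]_n} -> F) : Prop :=
  forall (x : {ffun 'I_k -> 'rV[F]_n}) (i : 'I_k),
    scalar (fun v : 'rV[F]_n => t (subst_at x i v)).

(* (x_1, ..., x_(k-1)), v |-> (x_1, ..., x_(k-1), v), for k > 0. *)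
Definition append_last (k : nat) (V : Type) (x : {ffun 'I_k.-1 -> V}) (v : V) :
    {ffun 'I_k -> V} :=
  [ffun i : 'I_k => if insub (val i) is Some j then x j else v].

(* The map T : V^(k-1) -> V with T(x) . v = t(x, v) for the standard bilinear
   form, when t is multilinear. *)
Definition dlin_map (F : fieldType) (n k : nat)
    (t : {ffun 'I_k -> 'rV[F]_n} -> F) (x : {ffun 'I_k.-1 -> 'rV[F]_n}) :
    'rV[F]_n :=
  \row_j t (append_last x (delta_mx 0 j)).

(* The multilinear map over L with the same values as t on the standard
   basis vectors. *)
Definition base_change (F L : fieldType) (iota : F -> L) (n k : nat)
    (t : {ffun 'I_k -> 'rV[F]_n} -> F) (x : {ffun 'I_k -> 'rV[L]_n}) : L :=
  \sum_(j : {ffun 'I_k -> 'I_n})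
    iota (t [ffun i => delta_mx 0 (j i)]) * \prod_i x i 0 (j i).

Definition analytic_rank (R : realType) (F : finFieldType) (n k : nat)
    (t : {ffun 'I_k -> 'rV[F]_n} -> F) : R :=
  - (ln (#|[set x : {ffun 'I_k.-1 -> 'rV[F]_n} | dlin_map t x == 0]|%:R
         / (#|{: 'rV[F]_n}| ^ k.-1)%:R)
     / ln #|F|%:R).

Section LocalRank.
Variables (F : fieldType) (n d : nat).
Local Notation V := 'rV[F]_n.
Implicit Types (T : {ffun 'I_d -> V} -> V) (p x : {ffun 'I_d -> V}).

(* Coordinates are numbered from 0: splice i p x takes the first i
   coordinates from p and the others from x. *)
Definition splice (i : nat) p x : {ffun 'I_d -> V} :=
  [ffun j : 'I_d => if (j < i)%N then p j else x j].

(* The matrix of v |-> T(x_1, ..., v, ..., x_d), with v in position i. *)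
Definition partial_mx T x (i : 'I_d) : 'M[F]_n :=
  lin1_mx (fun v : V => T (subst_at x i v)).

Definition admissible T p x : Prop :=
  forall i : nat, (1 <= i <= d.-1)%N -> T (splice i p x) = 0.

Definition rank_tuple T p x : {ffun 'I_d -> nat} :=
  [ffun i : 'I_d => \rank (partial_mx T (splice i.+1 p x) i)].

Definition colex_lt (a b : {ffun 'I_d -> nat}) : Prop :=
  exists2 i : 'I_d, (a i < b i)%N & forall j : 'I_d, (i < j)%N -> a j = b j.

Definition is_colex_max (A : set {ffun 'I_d -> nat}) (r : {ffun 'I_d -> nat}) :
    Prop :=
  A r /\ forall s, A s -> s = r \/ colex_lt s r.

(* For multilinear T the maximum exists, so the default value of xget is not
   used: x = 0 is admissible and the ranks are at most n. *)
Definition local_rank T p : {ffun 'I_d -> nat} :=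
  xget [ffun=> 0%N]
    (is_colex_max [set rank_tuple T p x | x in admissible T p]%classic).

End LocalRank.

Definition alg_closure (F : finFieldType) : closedFieldType :=
  projT1 (countable_algebraic_closure F).

Definition to_alg_closure (F : finFieldType) : {rmorphism F -> alg_closure F} :=
  sval (projT2 (countable_algebraic_closure F)).

Definition alg_local_rank (F : finFieldType) (n k : nat)
    (t : {ffun 'I_k -> 'rV[F]_n} -> F) (p : {ffun 'I_k.-1 -> 'rV[F]_n}) :
    {ffun 'I_k.-1 -> nat} :=
  local_rank (dlin_map (base_change (to_alg_closure F) t))
    [ffun i => map_mx (to_alg_closure F) (p i)].

Definition LR_stable (F : finFieldType) (n k : nat)
    (t : {ffun 'I_k -> 'rV[F]_n} -> F) (p : {ffun 'I_k.-1 -> 'rV[F]_n}) : Prop :=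
  local_rank (dlin_map t) p = alg_local_rank t p.

Definition weighted_norm (d : nat) (r : {ffun 'I_d -> nat}) : nat :=
  \sum_(i < d) 2 ^ (d - i.+1) * r i.

(* Main.v *)
Require Import Defs.
From mathcomp Require Import all_boot all_order all_algebra.
From mathcomp Require Import reals.
From HB Require Import structures.
From mathcomp Require Import perm mxabelem boolp classical_sets exp.
From mathcomp Require Import lra zify.
Import Order.TTheory GRing.Theory Num.Theory.
Local Open Scope ring_scope.

Set Implicit Arguments.
Unset Strict Implicit.
Unset Printing Implicit Defensive.

(** Write [D = k - 1] for the number of arguments of [T], [V] for the space of
    vectors, [q] for the size of the field and [AR] for the analytic rank of
    [T], and number coordinates from 0.  The point [p] is found by Gibbs
    sampling on the set [Z] of zeros of [T].

    Start at a uniform point [p] of [Z] and replace its coordinates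
    [D - 1, ..., 0], in this order, by uniform elements of the kernels of the
    maps [T(p_0, ..., p_(i-1), -, x_(i+1), ..., x_(D-1))]; call [x] the
    result.  It is admissible for [p], and the ranks of these maps are the
    rank tuple of [x] at [p].  Resampling a coordinate preserves the uniform
    measure on [Z] ([sum_gibbs_splice]), so the entry [i] of this tuple is
    distributed like the rank of the partial map [i] of [T] at a uniform point
    of [Z].  The average over [Z] of [q] to the power of this rank is
    [|V|^D / |Z| = q ^ AR], so that by Jensen's inequality the rank is at most
    [AR] on average ([sum_rank_le]).  Hence some [p] in [Z], fixed from now on,
    satisfies [E || ranks || <= (2 ^ D - 1) AR] ([small_expected_norm]).

    It remains to see that for this [p] the process attains the algebraic local
    rank [r] of [T] at [p] with probability at least [1 - delta], where [delta]
    is small; then [x] shows that [p] is stable, and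
    [|| r || (1 - delta) <= (2 ^ D - 1) AR].  Let [xbar] attain [r] over the
    algebraic closure.  The ranks of [x] are at least [r_i] where certain
    minors, nonzero at [xbar], do not vanish, and at most [r_i] as long as the
    previous ones are equal to [r], by maximality.  When the stage matrix [j]
    has the rank [r_j], a matrix with polynomial entries maps [xbar_j] into its
    kernel ([kernel_proj]).  Substituting this vector for the coordinate [j] in
    the condition under which the later ranks are likely to be maximal gives a
    polynomial condition on the coordinates above [j] under which the condition
    does not vanish identically on the kernel; by the Schwartz-Zippel bound
    ([schwartz_zippel_ker]) it then fails with probability at most
    [degree / (q - 1)] ([good_prob_step]).  The degrees that occur are bounded
    by products of [D - 1] factors, each of size [O(r_j + 1)].

    The degree is controlled by [AR]: if an entry of [r] were larger than twice
    [(2 ^ D - 1) AR], using a smaller minor at that stage would show that the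
    rank is that large with probability at least one half, against the bound
    on the expectation ([local_rank_attained]).  So [delta] is
    [O((AR + 1) ^ (D - 1) / q)], which is at most [eps / 2 ^ D]. *)

(** * Matrices of prescribed rank *)

Section RankMinors.
Variables (F : fieldType) (n : nat).
Implicit Types M : 'M[F]_n.

(** A matrix of rank at least [m] has an invertible minor of size [m], up to
    a change of coordinates in the source and in the target. *)
Lemma rank_ge_minor m M : (m <= \rank M)%N ->
  exists A : 'M[F]_(m, n), exists B : 'M[F]_(n, m), A *m M *m B = 1%:M.
Proof.
move=> hm; have hn := leq_trans hm (rank_leq_row M).
exists (pid_mx m *m invmx (col_ebase M)), (invmx (row_ebase M) *m pid_mx m).
rewrite -{2}(mulmx_ebase M) !mulmxA mulmxKV ?col_ebase_unit //.
rewrite mulmxK ?row_ebase_unit // !mul_pid_mx.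
have -> : minn n (minn m (\rank M)) = m by lia.
have -> : minn n (minn m m) = m by lia.
by rewrite pid_mx_1.
Qed.

Lemma minor_rank_ge m M (A : 'M[F]_(m, n)) (B : 'M[F]_(n, m)) :
  \det (A *m M *m B) != 0 -> (m <= \rank M)%N.
Proof.
rewrite -unitfE -unitmxE => hu.
have <- : \rank (A *m M *m B) = m by apply: mxrank_unit.
by apply: leq_trans (mxrankM_maxl _ _) (mxrankM_maxr _ _).
Qed.

(** A polynomial substitute for a projection onto the kernel of [M]: the
    entries are polynomials in those of [M], the kernel is multiplied by the
    minor [\det (A *m M *m B)], and the values lie in the kernel when the minor
    is nonzero and its size is the rank of [M]. *)
Definition kernel_proj m (A : 'M[F]_(m, n)) (B : 'M[F]_(n, m)) M : 'M[F]_n :=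
  (\det (A *m M *m B))%:M - M *m B *m \adj (A *m M *m B) *m A.

Lemma kernel_proj_ker m (A : 'M[F]_(m, n)) (B : 'M[F]_(n, m)) M (v : 'rV_n) :
  v *m M = 0 -> v *m kernel_proj A B M = \det (A *m M *m B) *: v.
Proof.
by move=> hv; rewrite mulmxBr !mulmxA hv !mul0mx subr0 mul_mx_scalar.
Qed.

Lemma kernel_projM m (A : 'M[F]_(m, n)) (B : 'M[F]_(n, m)) M :
  \rank M = m -> \det (A *m M *m B) != 0 -> kernel_proj A B M *m M = 0.
Proof.
move=> hr hd.
have hu : (A *m M *m B) \in unitmx by rewrite unitmxE unitfE.
have hAM : \rank (A *m M) = m.
  apply/eqP; rewrite eqn_leq rank_leq_row /=.
  by rewrite -{1}(mxrank_unit hu) mxrankM_maxl.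
have hsub : (M <= A *m M)%MS.
  by rewrite -(mxrank_leqif_sup (submxMl A M)) hr hAM.
case/submxP: hsub => X hX.
set N := A *m M *m B in hd hu *.
have hMB : M *m B = X *m N by rewrite {1}hX /N !mulmxA.
rewrite /kernel_proj -/N; clearbody N.
rewrite mulmxBl mul_scalar_mx hMB -!mulmxA (mulmxA N) mul_mx_adj.
by rewrite mul_scalar_mx -scalemxAr -hX subrr.
Qed.

End RankMinors.

(** * Functions of bounded degree along polynomial curves *)

Section CurveDegree.
Variables (L : fieldType) (d n : nat).
Local Notation X := {ffun 'I_d -> 'rV[L]_n}.

(** The point at time [s] of the curve with polynomial coordinates [c]. *)
Definition curve (c : 'I_d -> 'I_n -> {poly L}) (s : L) : X :=
  [ffun i => \row_a (c i a).[s]].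

(** [curve_deg D g]: along every polynomial curve of degree at most [e], the
    function [g] is a polynomial of degree at most [D * e].  This stands for
    polynomial functions of total degree at most [D]; with curves instead of
    lines, the notion is stable under composition. *)
Definition curve_deg (D : nat) (g : X -> L) : Prop :=
  forall (e : nat) (c : 'I_d -> 'I_n -> {poly L}),
    (forall i a, (size (c i a) <= e.+1)%N) ->
  exists2 P : {poly L}, (size P <= (D * e).+1)%N &
    forall s, P.[s] = g (curve c s).

Lemma curve_degW D D' g : (D <= D')%N -> curve_deg D g -> curve_deg D' g.
Proof.
move=> hD hg e c hc; have [P hP hPg] := hg e c hc.
by exists P => //; apply: leq_trans hP _; rewrite ltnS leq_mul2r hD orbT.
Qed.

Lemma curve_deg_eq D g g' : g =1 g' -> curve_deg D g -> curve_deg D g'.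
Proof.
move=> hgg hg e c hc; have [P hP hPg] := hg e c hc.
by exists P => // s; rewrite hPg hgg.
Qed.

Lemma curve_deg_cst D a : curve_deg D (fun=> a).
Proof.
move=> e c _; exists a%:P; last by move=> s; rewrite hornerC.
by apply: leq_trans (size_polyC_leq1 _) _.
Qed.

Lemma curve_deg_coord i a : curve_deg 1 (fun x => x i 0 a).
Proof.
move=> e c hc; exists (c i a); first by rewrite mul1n.
by move=> s; rewrite ffunE mxE.
Qed.

Lemma curve_degD D g h :
  curve_deg D g -> curve_deg D h -> curve_deg D (fun x => g x + h x).
Proof.
move=> hg hh e c hc; have [P hP hPg] := hg e c hc.
have [Q hQ hQh] := hh e c hc.
exists (P + Q); last by move=> s; rewrite hornerD hPg hQh.
by apply: leq_trans (size_polyD _ _) _; rewrite geq_max hP hQ.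
Qed.

Lemma curve_degM D E g h :
  curve_deg D g -> curve_deg E h -> curve_deg (D + E) (fun x => g x * h x).
Proof.
move=> hg hh e c hc; have [P hP hPg] := hg e c hc.
have [Q hQ hQh] := hh e c hc.
exists (P * Q); last by move=> s; rewrite hornerM hPg hQh.
by apply: leq_trans (size_polyMleq _ _) _; rewrite mulnDl; lia.
Qed.

Lemma curve_degZ D a g : curve_deg D g -> curve_deg D (fun x => a * g x).
Proof. by move=> hg; apply: (curve_degM (curve_deg_cst 0 a) hg). Qed.

Lemma curve_deg_sum (I : Type) (r : seq I) (g : I -> X -> L) D :
  (forall i, curve_deg D (g i)) -> curve_deg D (fun x => \sum_(i <- r) g i x).
Proof.
move=> hg; elim: r => [|i r IH].
  by apply: curve_deg_eq (curve_deg_cst D 0) => x; rewrite big_nil.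
by apply: curve_deg_eq (curve_degD (hg i) IH) => x; rewrite big_cons.
Qed.

Lemma curve_deg_prod (I : Type) (r : seq I) (g : I -> X -> L) D :
  (forall i, curve_deg D (g i)) ->
  curve_deg (size r * D) (fun x => \prod_(i <- r) g i x).
Proof.
move=> hg; elim: r => [|i r IH].
  by apply: curve_deg_eq (curve_deg_cst _ 1) => x; rewrite big_nil.
rewrite /= mulSn.
by apply: curve_deg_eq (curve_degM (hg i) IH) => x; rewrite big_cons.
Qed.

Lemma curve_deg_comp D E g (h : X -> X) :
  (forall i a, curve_deg E (fun x => h x i 0 a)) -> curve_deg D g ->
  curve_deg (D * E) (g \o h).
Proof.
move=> hh hg e c hc.
have /fin_all_exists[P hP] : forall i, exists P : 'I_n -> {poly L}, forall a,
    (size (P a) <= (E * e).+1)%N /\ forall s, (P a).[s] = h (curve c s) i 0 a.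
  move=> i; suff /fin_all_exists[P hP] : forall a, exists P : {poly L},
      (size P <= (E * e).+1)%N /\ forall s, P.[s] = h (curve c s) i 0 a.
    by exists P.
  by move=> a; have [P] := hh i a e c hc; exists P.
have [Q hQ hQg] := hg (E * e)%N P (fun i a => (hP i a).1).
exists Q; first by rewrite -mulnA.
move=> s; rewrite hQg /=; congr g; apply/ffunP => i; apply/rowP => a.
by rewrite !ffunE mxE (hP i a).2.
Qed.

(** Bounded degree for the entries of a matrix of functions. *)
Definition mx_curve_deg (p q D : nat) (N : X -> 'M[L]_(p, q)) : Prop :=
  forall i j, curve_deg D (fun x => N x i j).

Lemma mx_curve_degM p q r D E (N : X -> 'M[L]_(p, q)) (N' : X -> 'M[L]_(q, r)) :
  mx_curve_deg D N -> mx_curve_deg E N' ->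
  mx_curve_deg (D + E) (fun x => N x *m N' x).
Proof.
move=> hN hN' i j.
apply: (@curve_deg_eq _ (fun x => \sum_(l <- enum 'I_q) N x i l * N' x l j)).
  by move=> x; rewrite mxE big_enum.
by apply: curve_deg_sum => l; apply: curve_degM.
Qed.

Lemma mx_curve_deg_cst p q D (A : 'M[L]_(p, q)) : mx_curve_deg D (fun=> A).
Proof. by move=> i j; apply: curve_deg_cst. Qed.

Lemma curve_deg_det m D (N : X -> 'M[L]_m) :
  mx_curve_deg D N -> curve_deg (m * D) (fun x => \det (N x)).
Proof.
move=> hN.
apply: (@curve_deg_eq _ (fun x => \sum_(s <- enum {: {perm 'I_m}})
   (-1) ^+ s * \prod_(i <- enum 'I_m) N x i (s i))).
  by move=> x; rewrite big_enum; apply: eq_bigr => s _; rewrite big_enum.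
apply: curve_deg_sum => s; apply: curve_degZ.
rewrite -{1}(size_enum_ord m).
exact: (@curve_deg_prod _ _ (fun i x => N x i (s i))).
Qed.

Lemma mx_curve_deg_adj m D (N : X -> 'M[L]_m) :
  mx_curve_deg D N -> mx_curve_deg (m * D) (fun x => \adj (N x)).
Proof.
move=> hN i j.
apply: (@curve_deg_eq _
  (fun x => (-1) ^+ (j + i) * \det (row' j (col' i (N x))))).
  by move=> x; rewrite mxE.
apply: curve_degZ; apply: (@curve_degW (m.-1 * D)).
  by rewrite leq_mul2r leq_pred orbT.
apply: curve_deg_det => a b; apply: curve_deg_eq (hN (lift j a) (lift i b)).
by move=> x; rewrite !mxE.
Qed.

Lemma curve_deg_minor m D (A : 'M[L]_(m, n)) (B : 'M[L]_(n, m))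
    (M : X -> 'M[L]_n) :
  mx_curve_deg D M -> curve_deg (m * D) (fun x => \det (A *m M x *m B)).
Proof.
move=> hM; apply: curve_deg_det; rewrite -[D]addn0 -[(D + 0)%N]add0n addnA.
apply: mx_curve_degM (mx_curve_deg_cst _ _).
exact: mx_curve_degM (mx_curve_deg_cst _ _) hM.
Qed.

Lemma mx_curve_deg_kernel_proj m D (A : 'M[L]_(m, n)) (B : 'M[L]_(n, m))
    (M : X -> 'M[L]_n) :
  mx_curve_deg D M ->
  mx_curve_deg (m.+1 * D) (fun x => kernel_proj A B (M x)).
Proof.
move=> hM i j.
have hAMB : mx_curve_deg D (fun x => A *m M x *m B).
  rewrite -[D]addn0 -[(D + 0)%N]add0n addnA.
  apply: mx_curve_degM (mx_curve_deg_cst _ _).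
  exact: mx_curve_degM (mx_curve_deg_cst _ _) hM.
have hQ : mx_curve_deg (D + 0 + m * D + 0)
    (fun x => M x *m B *m \adj (A *m M x *m B) *m A).
  apply: mx_curve_degM (mx_curve_deg_cst _ _).
  apply: mx_curve_degM (mx_curve_deg_adj hAMB).
  exact: mx_curve_degM hM (mx_curve_deg_cst _ _).
apply: (@curve_deg_eq _ (fun x => (i == j)%:R * \det (A *m M x *m B) +
    (-1) * (M x *m B *m \adj (A *m M x *m B) *m A) i j)).
  by move=> x; rewrite [RHS]mxE [in RHS]mxE [in RHS]mxE mulN1r mulrC mulr_natr.
apply: curve_degD; apply: curve_degZ.
  by apply: curve_degW (curve_deg_det hAMB); rewrite mulSn leq_addl.
by apply: curve_degW (hQ i j); rewrite mulSn !addn0.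
Qed.

End CurveDegree.

(** * A Schwartz-Zippel bound on the kernel of a matrix *)

Section SchwartzZippel.
Variables (F : finFieldType) (L : fieldType) (iota : {rmorphism F -> L}).

(** [line_deg D h]: the restriction of [h] to every line is a polynomial of
    degree at most [D]. *)
Definition line_deg n (D : nat) (h : 'rV[L]_n -> L) : Prop :=
  forall a b : 'rV[L]_n, exists2 P : {poly L}, (size P <= D.+1)%N &
    forall s, P.[s] = h (a + s *: b).

Lemma nonroot (P : {poly L}) : P != 0 -> (size P <= #|F|)%N ->
  exists s : F, P.[iota s] != 0.
Proof.
move=> hP hs; apply/existsP; apply: contraLR hs; rewrite negb_exists -ltnNge.
move=> /forallP hall.
have := max_poly_roots hP (rs := [seq iota s | s <- enum F]).
rewrite size_map -cardE; apply; last first.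
  by rewrite map_inj_uniq ?enum_uniq //; apply: fmorph_inj.
apply/allP => _ /mapP[s _ ->]; rewrite /root.
by have := hall s; rewrite negbK.
Qed.

(** A function of low degree which does not vanish identically over the large
    field does not vanish identically over the small one: the coordinates of
    a point can be moved into the small field one at a time. *)
Lemma rational_nonzero n D (h : 'rV[L]_n -> L) (u : 'rV[L]_n) :
  line_deg D h -> (D < #|F|)%N -> h u != 0 ->
  exists w : 'rV[F]_n, h (map_mx iota w) != 0.
Proof.
move=> hh hD hu.
have key l : (l <= n)%N -> exists2 w : 'rV[L]_n, h w != 0 &
    forall j : 'I_n, (j < l)%N -> exists s, w 0 j = iota s.
  elim: l => [|l IH] hl; first by exists u.
  have [w hw hwl] := IH (ltnW hl).
  pose j0 := Ordinal hl.
  have [P hP hPh] := hh w (delta_mx 0 j0).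
  (* The point of the line at time [s] has the coordinate [w 0 j0 + s]. *)
  pose Q := P \Po ('X - (w 0 j0)%:P).
  have hQ0 : Q.[w 0 j0] != 0.
    by rewrite horner_comp !hornerE subrr hPh scale0r addr0.
  have [||s hs] := @nonroot Q.
  - by apply: contraNneq hQ0 => ->; rewrite horner0.
  - by rewrite size_comp_poly2 ?size_XsubC //; apply: leq_trans hP hD.
  rewrite horner_comp !hornerE hPh in hs.
  exists (w + (iota s - w 0 j0) *: delta_mx 0 j0) => // j.
  rewrite ltnS leq_eqVlt => /orP[/eqP hj|hj].
    exists s; have -> : j = j0 by apply: val_inj.
    by rewrite !mxE !eqxx mulr1 addrC subrK.
  have [s' hs'] := hwl j hj; exists s'; rewrite !mxE hs' eqxx /=.
  have -> : (j == j0) = false by apply: contraTF hj => /eqP ->; rewrite ltnn.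
  by rewrite mulr0 addr0.
have [w hw hwn] := key n (leqnn n).
have /fin_all_exists[f hf] : forall j : 'I_n, exists s, w 0 j = iota s.
  by move=> j; apply: hwn.
exists (\row_j f j); have -> // : map_mx iota (\row_j f j) = w.
by apply/rowP => j; rewrite !mxE hf.
Qed.

(** The lines of the kernel through a point where [h] is nonzero cover the
    kernel, and [h] has at most [D] zeros on each of them. *)
Lemma schwartz_zippel_ker n D (h : 'rV[L]_n -> L) (M : 'M[F]_n)
    (v : 'rV[L]_n) :
  line_deg D h -> (D < #|F|)%N -> v *m map_mx iota M = 0 -> h v != 0 ->
  (#|[set w : 'rV[F]_n | (w *m M == 0%R) && (h (map_mx iota w) == 0%R)]|
     * #|F|.-1 <= D * #|[set w : 'rV[F]_n | w *m M == 0%R]|)%N.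
Proof.
move=> hh hD hv hvh.
have [v0 hv0 hv0h] : exists2 v0 : 'rV[F]_n,
    v0 *m M = 0 & h (map_mx iota v0) != 0.
  have hN : v = v *m pinvmx (kermx (map_mx iota M)) *m map_mx iota (kermx M).
    by rewrite map_kermx mulmxKpV //; apply/sub_kermxP.
  pose h' u := h (u *m map_mx iota (kermx M)).
  have hh' : line_deg D h'.
    move=> a b; have [P hP hPh] := hh (a *m map_mx iota (kermx M))
      (b *m map_mx iota (kermx M)).
    by exists P => // s; rewrite hPh /h' mulmxDl scalemxAl.
  have [|w hw] := rational_nonzero hh' hD
    (u := v *m pinvmx (kermx (map_mx iota M))); first by rewrite /h' -hN.
  exists (w *m kermx M); first by rewrite -mulmxA mulmx_ker mulmx0.
  by rewrite map_mxM.
set K := [set w | w *m M == 0]; set Z := [set w | _ && _].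
(* Count the pairs of a kernel vector [w] and a nonzero [s] such that the point
   [v0 + s (w - v0)] is a zero; for fixed [s] this point runs through the
   kernel. *)
have hZ (s : F) : s != 0 ->
    (#|Z| = \sum_(w in K) (h (map_mx iota (v0 + s *: (w - v0)))%R == 0%R))%N.
  move=> hs.
  have hbij : {on [pred w | w \in K],
      bijective (fun w : 'rV[F]_n => v0 + s *: (w - v0))}.
    apply: onW_bij.
    exists (fun w => v0 + s^-1 *: (w - v0)) => w;
      by rewrite [X in _ *: X]addrAC subrr add0r scalerA ?mulVf ?mulfV //
        scale1r addrC subrK.
  rewrite -sum1_card.
  transitivity (\sum_(w in K) (h (map_mx iota w) == 0%R))%N.
    rewrite big_mkcond [RHS]big_mkcond; apply: eq_bigr => w _.
    by rewrite !inE; case: (_ *m _ == 0) => //=; case: (h _ == 0).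
  rewrite (reindex _ hbij) /=; apply: eq_bigl => w.
  rewrite !inE mulmxDl hv0 add0r -scalemxAl mulmxBl hv0 subr0 scaler_eq0.
  by rewrite (negPf hs).
have -> : (#|Z| * #|F|.-1 = \sum_(s : F | s != 0%R) #|Z|)%N.
  by rewrite sum_nat_const mulnC -(cardC1 (0 : F)); congr (_ * _)%N;
    apply: eq_card => s.
rewrite (eq_bigr _ hZ) exchange_big /= mulnC -sum_nat_const.
apply: leq_sum => w _.
have [P hP hPh] := hh (map_mx iota v0) (map_mx iota (w - v0)).
have hP0 : P != 0.
  apply: contraNneq hv0h => P0; have := hPh 0.
  by rewrite P0 horner0 scale0r addr0 => <-.
rewrite -big_mkcondr sum1_card.
rewrite cardE; set rs := enum _.
suff : (size (map iota rs) < size P)%N.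
  by rewrite size_map => hrs; rewrite -ltnS; apply: leq_trans hrs hP.
apply: (max_poly_roots hP0); last first.
  by rewrite map_inj_uniq ?enum_uniq //; apply: fmorph_inj.
apply/allP => y /mapP[s + ->]; rewrite mem_enum unfold_in => /andP[_ /eqP hs].
by rewrite /root hPh -map_mxZ -map_mxD hs.
Qed.

End SchwartzZippel.

(** * Multilinear maps and their stage matrices *)

(** A function with a proof of linearity, as a bundled linear map. *)
Definition as_linear (F : fieldType) (m n : nat) (f : 'rV[F]_m -> 'rV[F]_n)
    (hf : linear f) : {linear 'rV[F]_m -> 'rV[F]_n} :=
  HB.pack f (GRing.isLinear.Build F 'rV[F]_m 'rV[F]_n _ f hf).

(** Linearity in each argument, for vector-valued maps. *)
Definition multilinear_map (F : fieldType) (n d : nat)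
    (T : {ffun 'I_d -> 'rV[F]_n} -> 'rV[F]_n) : Prop :=
  forall x i, linear (fun v => T (subst_at x i v)).

Lemma eq_mulmx_row (F : fieldType) m n (A B : 'M[F]_(m, n)) :
  (forall v : 'rV_m, v *m A = v *m B) -> A = B.
Proof. by move=> h; apply/row_matrixP => i; rewrite !rowE h. Qed.

Section Stage.
Variables (F : fieldType) (n d : nat).
Local Notation V := 'rV[F]_n.
Local Notation X := {ffun 'I_d -> V}.
Variable T : X -> V.
Implicit Types (p x y : X) (i : 'I_d) (v : V).

(** The matrix whose rank is the entry [i] of the local rank; it depends only
    on the coordinates of [p] below [i] and on those of [x] above [i]. *)
Definition stage_mx (p x : X) (i : 'I_d) : 'M[F]_n :=
  partial_mx T (splice i.+1 p x) i.

Lemma eq_stage_mx p x y i :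
  (forall j : 'I_d, (i < j)%N -> x j = y j) -> stage_mx p x i = stage_mx p y i.
Proof.
move=> h; rewrite /stage_mx; congr (partial_mx T _ i); apply/ffunP => j.
by rewrite !ffunE ltnS; case: leqP => // /h.
Qed.

Lemma rank_tupleE p x i : rank_tuple T p x i = \rank (stage_mx p x i).
Proof. by rewrite ffunE. Qed.

Lemma splice_subst_at (p x : X) (i : 'I_d) v :
  subst_at (splice i.+1 p x) i v = splice i p (subst_at x i v).
Proof.
apply/ffunP => j; rewrite !ffunE ltnS leq_eqVlt.
have [->|hj] := eqVneq j i; first by rewrite ltnn.
by have -> : (j == i :> nat) = false by apply: contra_neqF hj => /eqP/val_inj.
Qed.

Hypothesis T_lin : multilinear_map T.

Lemma mul_partial_mx x i v : v *m partial_mx T x i = T (subst_at x i v).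
Proof. exact: (mul_rV_lin1 (as_linear (T_lin x i))). Qed.

Lemma mul_stage_mx p x i v :
  v *m stage_mx p x i = T (splice i p (subst_at x i v)).
Proof. by rewrite mul_partial_mx splice_subst_at. Qed.

Lemma subst_at_same (x : X) i : subst_at x i (x i) = x.
Proof. by apply/ffunP => j; rewrite ffunE; case: eqP => // ->. Qed.

Lemma admissibleP p x : admissible T p x <->
  forall i : 'I_d, (0 < i)%N -> x i *m stage_mx p x i = 0.
Proof.
split=> h i hi.
  rewrite mul_stage_mx subst_at_same h // hi -ltnS prednK ?ltn_ord //.
  exact: leq_ltn_trans (ltn_ord i).
case/andP: hi => hi1 hi2; have hid : (i < d)%N by lia.
have := h (Ordinal hid); rewrite mul_stage_mx subst_at_same; exact.
Qed.

Lemma multilinear_mapZ (c : 'I_d -> F) (y : X) :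
  T [ffun i => c i *: y i] = (\prod_i c i) *: T y.
Proof.
have key m : (m <= d)%N ->
    T [ffun i : 'I_d => if (i < m)%N then c i *: y i else y i]
    = (\prod_(i < d | (i < m)%N) c i) *: T y.
  elim: m => [|m IH] hm.
    rewrite big_pred0 ?scale1r //; congr T; apply/ffunP => i.
    by rewrite ffunE.
  pose i0 := Ordinal hm; 
  set z := [ffun i : 'I_d => if (i < m)%N then _ else _] in IH.
  have -> : [ffun i : 'I_d => if (i < m.+1)%N then c i *: y i else y i]
      = subst_at z i0 (c i0 *: y i0).
    apply/ffunP => i; rewrite !ffunE ltnS leq_eqVlt.
    have [->|hi] := eqVneq i i0; first by rewrite eqxx.
    have -> // : (i == m :> nat) = false.
    by apply: contra_neqF hi => /eqP h; apply: val_inj.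
  have hlin := linearZ_LR (as_linear (T_lin z i0)) (c i0) (y i0).
  rewrite /= in hlin; rewrite hlin.
  have -> : subst_at z i0 (y i0) = z.
    rewrite -[RHS](subst_at_same z i0); congr subst_at.
    by rewrite ffunE ltnn.
  rewrite IH ?(ltnW hm) // scalerA [in RHS](bigD1 i0) ?leqnn //=.
  congr (_ *: _); congr (_ * _); apply: eq_bigl => i.
  by rewrite ltnS [RHS]andbC ltn_neqAle; congr andb.
rewrite -(eq_bigl _ _ (ltn_ord (n := d))) -key //; congr T.
by apply/ffunP => i; rewrite !ffunE ltn_ord.
Qed.

Lemma stage_mx_scale p x y (c : 'I_d -> F) i :
  (forall j, c j != 0) ->
  (forall j : 'I_d, (i < j)%N -> x j = c j *: y j) ->
  exists2 a, a != 0 & stage_mx p x i = a *: stage_mx p y i.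
Proof.
move=> hc hx; pose c' (j : 'I_d) := if (i < j)%N then c j else 1.
exists (\prod_j c' j).
  by apply/prodf_neq0 => j _; rewrite /c'; case: ifP; rewrite ?oner_eq0.
apply: eq_mulmx_row => v; rewrite -scalemxAr !mul_stage_mx -multilinear_mapZ.
congr T; apply/ffunP => j; rewrite !ffunE /c'.
case: (ltngtP j i) => hj; rewrite ?scale1r //.
by case: eqP hj => [->|_ hj]; rewrite ?ltnn // hx.
by have /val_inj-> := hj; rewrite eqxx.
Qed.

(** A colexicographic maximum bounds the first rank that is not prescribed,
    as setting the lower coordinates to zero keeps a point admissible. *)
Lemma colex_max_stage p r x (j : 'I_d) :
  is_colex_max [set rank_tuple T p x | x in admissible T p]%classic r ->
  (forall l : 'I_d, (j < l)%N ->
     x l *m stage_mx p x l = 0 /\ \rank (stage_mx p x l) = r l) ->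
  (\rank (stage_mx p x j) <= r j)%N.
Proof.
move=> [_ hmax] hx.
pose y : X := [ffun l : 'I_d => if (j < l)%N then x l else 0].
have hy (l : 'I_d) : (j <= l)%N -> stage_mx p y l = stage_mx p x l.
  move=> hl; apply: eq_stage_mx => l' hl'.
  by rewrite ffunE (leq_ltn_trans hl hl').
have hyA : admissible T p y.
  apply/admissibleP => l _; rewrite [y l]ffunE; case: ifP => hl.
    by rewrite (hy l (ltnW hl)) (hx l hl).1.
  exact: mul0mx.
rewrite -(hy j (leqnn j)) -rank_tupleE.
have [->//|[i hi heq]] := hmax _ (imageP _ hyA).
case: (ltngtP i j) => hij.
- by rewrite heq.
- by move: hi; rewrite rank_tupleE hy ?(ltnW hij) // (hx i hij).2 ltnn.
- by have /val_inj<- := hij; apply: ltnW.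
Qed.

End Stage.

Lemma colex_max_unique d (A : set {ffun 'I_d -> nat}) r s :
  is_colex_max A r -> is_colex_max A s -> r = s.
Proof.
move=> [hr hrm] [hs hsm].
have [//|[i hi hij]] := hsm _ hr; have [//|[j hj hji]] := hrm _ hs.
case: (ltngtP i j) => h.
- by move: hj; rewrite hij // ltnn.
- by move: hi; rewrite hji // ltnn.
- by move: hi hj; have /val_inj-> := h; move=> h1 h2; lia.
Qed.

(** The colexicographic order on tuples bounded by [m] is the order of the
    numbers with these digits in base [m + 1]. *)
Lemma colex_max_exists d m (A : set {ffun 'I_d -> nat}) r0 :
  A r0 -> (forall r, A r -> forall i, (r i <= m)%N) ->
  exists r, is_colex_max A r.
Proof.
move=> hr0 hA.
pose w (r : {ffun 'I_d -> nat}) := (\sum_(i < d) r i * m.+1 ^ i)%N.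
have wE r (i : 'I_d) : w r = (\sum_(j < d | (j < i)%N) r j * m.+1 ^ j
    + (r i * m.+1 ^ i + \sum_(j < d | (i < j)%N) r j * m.+1 ^ j))%N.
  rewrite /w (bigID (fun j : 'I_d => (j < i)%N)) /=; congr (_ + _)%N.
  rewrite (bigD1 i) ?ltnn //=; congr (_ + _)%N; apply: eq_bigl => j.
  by rewrite -leqNgt [RHS]ltn_neqAle andbC eq_sym; congr andb.
have hw r s : A r -> colex_lt r s -> (w r < w s)%N.
  move=> hr [i hi hij].
  have small l : (l <= d)%N ->
      (\sum_(j < d | (j < l)%N) r j * m.+1 ^ j < m.+1 ^ l)%N.
    elim: l => [|l IH] hl; first by rewrite big_pred0.
    rewrite (bigD1 (Ordinal hl)) ?leqnn //= expnS.
    rewrite (eq_bigl (fun j : 'I_d => (j < l)%N)); last first.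
      by move=> j; rewrite ltnS [RHS]ltn_neqAle andbC; congr andb.
    rewrite mulSn addnC -addSn leq_add ?IH ?(ltnW hl) //.
    by rewrite leq_mul2r hA ?orbT.
  have heq : (\sum_(j < d | (i < j)%N) r j * m.+1 ^ j
      = \sum_(j < d | (i < j)%N) s j * m.+1 ^ j)%N.
    by apply: eq_bigr => j hj; rewrite hij.
  rewrite !(wE _ i) heq.
  have h1 := small i (ltnW (ltn_ord i)).
  have h2 : (r i * m.+1 ^ i + m.+1 ^ i <= s i * m.+1 ^ i)%N.
    by rewrite addnC -mulSn leq_mul2r hi orbT.
  lia.
pose P := [pred k : nat | `[< exists2 r, A r & w r = k >]].
have hPex : exists k, P k by exists (w r0); apply/asboolP; exists r0.
have hPle k : P k -> (k <= \sum_(i < d) m * m.+1 ^ i)%N.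
  move=> /asboolP[r hr <-]; apply: leq_sum => i _.
  by rewrite leq_mul2r hA ?orbT.
case: (ex_maxnP hPex hPle) => k /asboolP[r hr hrk] hkmax.
exists r; split=> // s hs.
have [->|hne] := eqVneq s r; [by left | right].
have [i0 hi0] : exists i, s i != r i.
  apply/existsP; apply: contraNT hne; rewrite negb_exists => /forallP h.
  by apply/eqP/ffunP => i; have := h i; rewrite negbK => /eqP.
case: (@arg_maxnP _ i0 (fun i => s i != r i) val hi0) => i hi himax.
have heq (j : 'I_d) : (i < j)%N -> s j = r j.
  by move=> hj; apply/eqP; apply: contraLR hj => /himax; rewrite -leqNgt.
exists i => //; move: hi; rewrite neq_ltn => /orP[//|hlt].
have h : (w r < w s)%N by apply: hw => //; exists i => // j /heq.
have : (w s <= k)%N by apply: hkmax; apply/asboolP; exists s.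
by rewrite -hrk leqNgt h.
Qed.

(** * Gibbs sampling on the zeros of a multilinear map *)

Section Gibbs.
Variables (R : realType) (F : finFieldType) (n d : nat).
Local Notation V := 'rV[F]_n.
Local Notation X := {ffun 'I_d.+1 -> V}.
Variable T : X -> V.
Hypothesis T_lin : multilinear_map T.
Implicit Types (x y p : X) (f : X -> R) (M : 'M[F]_n).

(** The kernel of a matrix, as a finite set of row vectors. *)
Definition kerset (M : 'M[F]_n) : {set V} := [set v | v *m M == 0].

Lemma kerset_gt0 M : 0 < #|kerset M|%:R :> R.
Proof.
by rewrite ltr0n card_gt0; apply/set0Pn; exists 0; rewrite inE mul0mx.
Qed.

Lemma card_kerset M : (#|kerset M| * #|F| ^ \rank M)%N = #|{: V}|.
Proof.
have -> : kerset M = rowg (kermx M).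
  by apply/setP => v; rewrite !inE sub_kermx.
rewrite card_rowg mxrank_ker -expnD subnK ?rank_leq_row //.
by rewrite card_mx mul1n.
Qed.

(** [avg K h]: the average of [h] over [K]. *)
Definition avg (K : {set V}) (h : V -> R) : R := (\sum_(v in K) h v) / #|K|%:R.

Lemma avg_le M h1 h2 : (forall v, v *m M = 0 -> h1 v <= h2 v) ->
  avg (kerset M) h1 <= avg (kerset M) h2.
Proof.
move=> hh; rewrite ler_pM2r ?invr_gt0 ?kerset_gt0 //.
by apply: ler_sum => v; rewrite inE => /eqP/hh.
Qed.

Lemma avg_cst M c : avg (kerset M) (fun=> c) = c.
Proof.
by rewrite /avg sumr_const -[c *+ _]mulr_natr mulfK // gt_eqF ?kerset_gt0.
Qed.

(** [gibbs p l h x]: the expected value of [h] at the end of the process which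
    starts at [x] and replaces the coordinates [l - 1, ..., 0], in this order,
    by uniform elements of the kernels of the stage matrices. *)
Fixpoint gibbs (p : X) (l : nat) (h : X -> R) (x : X) : R :=
  if l is l'.+1 then
    avg (kerset (stage_mx T p x (inord l')))
      (fun v => gibbs p l' h (subst_at x (inord l') v))
  else h x.

Lemma gibbs_le p l h1 h2 x : (l <= d.+1)%N ->
  (forall y, (forall j : 'I_d.+1, (l <= j)%N -> y j = x j) -> h1 y <= h2 y) ->
  gibbs p l h1 x <= gibbs p l h2 x.
Proof.
elim: l x => [|l IH] x hl hh /=; first by apply: hh.
apply: avg_le => v _; apply: IH (ltnW hl) _ => y hy; apply: hh => j hj.
rewrite hy ?(ltnW hj) // ffunE; case: eqP hj => // ->.
by rewrite inordK // ltnn.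
Qed.

Lemma gibbs_cst p l c x : gibbs p l (fun=> c) x = c.
Proof.
elim: l x => [|l IH] x //=.
by rewrite -[RHS](avg_cst (stage_mx T p x (inord l)) c); congr avg;
  apply/funext => v; rewrite IH.
Qed.

Lemma gibbs_sum p l (I : Type) (r : seq I) (c : I -> R) (h : I -> X -> R) x :
  gibbs p l (fun y => \sum_(i <- r) c i * h i y) x
  = \sum_(i <- r) c i * gibbs p l (h i) x.
Proof.
elim: l x => [|l IH] x //=; rewrite /avg.
rewrite [in LHS](eq_bigr _ (fun v _ => IH (subst_at x (inord l) v))).
rewrite exchange_big mulr_suml; apply: eq_bigr => i _.
by rewrite -mulr_sumr mulrA.
Qed.

Lemma gibbsZ p l c h x : gibbs p l (fun y => c * h y) x = c * gibbs p l h x.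
Proof.
have := gibbs_sum p l [:: tt] (fun=> c) (fun=> h) x; rewrite big_seq1 => <-.
by congr gibbs; apply/funext => y; rewrite big_seq1.
Qed.

(** The zeros of [T]. *)
Definition zeros : {set X} := [set x | T x == 0].

Lemma zeros_neq0 : (0 < #|zeros|)%N.
Proof.
rewrite card_gt0; apply/set0Pn; exists [ffun=> 0]; rewrite inE.
rewrite -(subst_at_same [ffun=> 0] ord0) -(mul_partial_mx T_lin) ffunE.
by rewrite mul0mx.
Qed.

Lemma partial_mx_subst_at x i v :
  partial_mx T (subst_at x i v) i = partial_mx T x i.
Proof.
apply: eq_mulmx_row => w; rewrite !mul_partial_mx //; congr T.
by apply/ffunP => j; rewrite !ffunE; case: eqP.
Qed.

Lemma subst_at_zeros x i v :
  (subst_at x i v \in zeros) = (v \in kerset (partial_mx T x i)).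
Proof. by rewrite !inE mul_partial_mx. Qed.

(** Summing over all values of one coordinate of every point counts every
    point as many times as there are vectors. *)
Lemma sum_subst_at (i : 'I_d.+1) (g : X -> R) :
  \sum_x \sum_v g (subst_at x i v) = #|{: V}|%:R * \sum_x g x.
Proof.
rewrite pair_big /=.
pose swap (z : X * V) := (subst_at z.1 i z.2, z.1 i).
have swapK : involutive swap.
  move=> [x v]; rewrite /swap /=; congr (_, _); last by rewrite ffunE eqxx.
  by apply/ffunP => j; rewrite !ffunE; case: eqP => // ->.
rewrite (reindex_inj (inv_inj swapK)) /=.
rewrite (eq_bigr (fun z : X * V => g z.1)); last first.
  move=> [x v] _ /=; congr g.
  by apply/ffunP => j; rewrite !ffunE; case: eqP => // ->.
rewrite -(pair_big xpredT xpredT (fun x (v : V) => g x)) /= mulr_sumr.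
by apply: eq_bigr => x _; rewrite sumr_const mulr_natl.
Qed.

Lemma sum_zeros_subst_at (i : 'I_d.+1) (g : X -> R) :
  #|{: V}|%:R * \sum_(x in zeros) g x
  = \sum_x \sum_(v in kerset (partial_mx T x i)) g (subst_at x i v).
Proof.
rewrite [X in _ * X]big_mkcond -(sum_subst_at i); apply: eq_bigr => x _.
rewrite [RHS]big_mkcond; apply: eq_bigr => v _.
by rewrite subst_at_zeros.
Qed.

Lemma card_V_neq0 : #|{: V}|%:R != 0 :> R.
Proof. by rewrite pnatr_eq0 -lt0n; apply/card_gt0P; exists 0. Qed.

(** The expected value of [f] after the coordinate [i] of [x] is replaced by a
    uniform vector among those which give a zero of [T]. *)
Definition resample (i : 'I_d.+1) (f : X -> R) (x : X) : R :=
  avg (kerset (partial_mx T x i)) (fun v => f (subst_at x i v)).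

(** Resampling one coordinate preserves the uniform measure on the zeros. *)
Lemma sum_resample i f :
  \sum_(x in zeros) resample i f x = \sum_(x in zeros) f x.
Proof.
apply: (mulfI card_V_neq0); rewrite !(sum_zeros_subst_at i).
apply: eq_bigr => x _; set K := kerset _.
rewrite (eq_bigr (fun=> avg K (fun v => f (subst_at x i v)))); last first.
  move=> v _; rewrite /resample partial_mx_subst_at; congr avg.
  by apply/funext => w; congr f; apply/ffunP => j; rewrite !ffunE; case: eqP.
by rewrite sumr_const -mulr_natr mulfVK // gt_eqF ?kerset_gt0.
Qed.

(** When the process starts at [p], the state before the coordinates below [i]
    are resampled is uniform if [p] is. *)
Lemma sum_gibbs_splice i f : (i <= d.+1)%N ->
  \sum_(p in zeros) gibbs p d.+1 (fun x => f (splice i p x)) p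
  = \sum_(p in zeros) f p.
Proof.
move=> hi.
pose rs := fix rs m :=
  if m is m'.+1 then resample (inord (i + m')) (rs m') else f.
have hrs m : \sum_(x in zeros) rs m x = \sum_(x in zeros) f x.
  by elim: m => [|m IH] //=; rewrite sum_resample.
have key p m x : (i + m <= d.+1)%N ->
    (forall j : 'I_d.+1, (j < i + m)%N -> x j = p j) ->
    gibbs p (i + m) (fun x => f (splice i p x)) x = rs m x.
  elim: m x => [|m IH] x.
    rewrite addn0 => _ hx; rewrite -[RHS](gibbs_cst p i _ x).
    have heq y : (forall j : 'I_d.+1, (i <= j)%N -> y j = x j) ->
        f (splice i p y) = f x.
      move=> hy; congr f; apply/ffunP => j; rewrite ffunE.
      by case: ltnP => hj; [rewrite hx | rewrite hy].
    by apply/eqP; rewrite eq_le; apply/andP; split;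
      apply: gibbs_le => // y /heq->.
  rewrite addnS => hm hx /=.
  have -> : stage_mx T p x (inord (i + m)) = partial_mx T x (inord (i + m)).
    congr partial_mx; apply/ffunP => j; rewrite ffunE inordK //.
    by case: ltnP => // hj; rewrite hx.
  congr avg; apply/funext => v; apply: IH; first exact: ltnW.
  move=> j hj; rewrite ffunE; case: eqP hj => [->|_ hj].
    by rewrite inordK // ltnn.
  by rewrite hx // ltnS ltnW.
rewrite -(hrs (d.+1 - i)%N); apply: eq_bigr => p _.
have := key p (d.+1 - i)%N p; rewrite subnKC //; apply=> //.
Qed.

(** For each value of the other coordinates, the coordinate [i] of a zero ranges
    over a kernel with [|V| / q ^ rank] elements. *)
Lemma sum_zeros_card_pow (i : 'I_d.+1) :
  \sum_(x in zeros) (#|F| ^ \rank (partial_mx T x i))%:R = #|{: X}|%:R :> R.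
Proof.
apply: (mulfI card_V_neq0); rewrite (sum_zeros_subst_at i).
rewrite (eq_bigr (fun=> #|{: V}|%:R)); last first.
  move=> x _; rewrite (eq_bigr (fun=> (#|F| ^ \rank (partial_mx T x i))%:R)).
    by rewrite sumr_const -mulrnA mulnC card_kerset.
  by move=> v _; rewrite partial_mx_subst_at.
by rewrite sumr_const [RHS]mulr_natr.
Qed.

(** Jensen's inequality for the logarithm turns the previous identity into a
    bound on the average rank at a zero by the analytic rank. *)
Lemma sum_rank_le (i : 'I_d.+1) :
  \sum_(x in zeros) (\rank (partial_mx T x i))%:R
    <= #|zeros|%:R * - (ln (#|zeros|%:R / #|{: X}|%:R) / ln #|F|%:R) :> R.
Proof.
have hF : (1 < #|F|)%N by apply: finalg.card_finNzRing_gt1.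
have hln : 0 < ln (#|F|%:R : R) by rewrite ln_gt0 // ltr1n.
have hZ : 0 < #|zeros|%:R :> R by rewrite ltr0n zeros_neq0.
have hX : 0 < #|{: X}|%:R :> R.
  by rewrite ltr0n; apply/card_gt0P; exists [ffun=> 0].
set Q : R := #|zeros|%:R / #|{: X}|%:R.
have hQ : 0 < Q by rewrite divr_gt0.
rewrite -mulNr mulrA ler_pdivlMr // mulr_suml.
apply: (@le_trans _ _ (\sum_(x in zeros)
    ((#|F| ^ \rank (partial_mx T x i))%:R * Q - 1 - ln Q))).
  apply: ler_sum => x _; set r := \rank _.
  have hr : 0 < (#|F| ^ r)%:R :> R by rewrite ltr0n expn_gt0 (ltnW hF).
  have hl : ln ((#|F| ^ r)%:R : R) = r%:R * ln #|F|%:R.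
    by rewrite natrX lnXn ?ltr0n ?(ltnW hF) // mulr_natl.
  have : ln (1 + ((#|F| ^ r)%:R * Q - 1)) <= (#|F| ^ r)%:R * Q - 1.
    by apply: le_ln1Dx; have := mulr_gt0 hr hQ; lra.
  rewrite addrC subrK lnM ?posrE // hl; lra.
rewrite big_split /= big_split /= -mulr_suml sum_zeros_card_pow !sumr_const.
rewrite /Q mulrCA mulfV ?gt_eqF // mulr1 -[- ln _ *+ _]mulr_natl.
by rewrite mulNrn subrr add0r.
Qed.

End Gibbs.

(** * The sampling process attains the algebraic local rank *)

Section Attain.
Variables (R : realType) (F : finFieldType) (L : fieldType).
Variables (iota : {rmorphism F -> L}) (n d : nat).
Local Notation V := 'rV[F]_n.
Local Notation V' := 'rV[L]_n.
Local Notation X := {ffun 'I_d.+1 -> V}.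
Local Notation X' := {ffun 'I_d.+1 -> V'}.
Variables (T : X -> V) (T' : X' -> V').
Hypothesis T_lin : multilinear_map T.
Hypothesis T'_lin : multilinear_map T'.

(** Extension of scalars for tuples of vectors. *)
Definition lift_pt (x : X) : X' := [ffun i => map_mx iota (x i)].

Hypothesis T'_lift : forall x, T' (lift_pt x) = map_mx iota (T x).
Hypothesis T'_deg : forall b, curve_deg d.+1 (fun x => T' x 0 b).
Implicit Types (i j l : 'I_d.+1).

Lemma lift_splice k x y :
  splice k (lift_pt x) (lift_pt y) = lift_pt (splice k x y).
Proof. by apply/ffunP => j; rewrite !ffunE; case: ifP. Qed.

Lemma lift_subst_at x i v :
  subst_at (lift_pt x) i (map_mx iota v) = lift_pt (subst_at x i v).
Proof. by apply/ffunP => j; rewrite !ffunE; case: eqP. Qed.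

Lemma lift_stage_mx p x i :
  stage_mx T' (lift_pt p) (lift_pt x) i = map_mx iota (stage_mx T p x i).
Proof.
rewrite /stage_mx /partial_mx lift_splice.
by symmetry; apply: map_lin1_mx => v; rewrite lift_subst_at T'_lift.
Qed.

Lemma lift_rank p x i :
  \rank (stage_mx T' (lift_pt p) (lift_pt x) i) = \rank (stage_mx T p x i).
Proof. by rewrite lift_stage_mx mxrank_map. Qed.

Lemma lift_rank_tuple p x :
  rank_tuple T' (lift_pt p) (lift_pt x) = rank_tuple T p x.
Proof. by apply/ffunP => i; rewrite !rank_tupleE lift_rank. Qed.

Lemma lift_admissible p x :
  admissible T p x -> admissible T' (lift_pt p) (lift_pt x).
Proof. by move=> hx i hi; rewrite lift_splice T'_lift hx // map_mx0. Qed.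

Lemma stage_mx_deg p' i : mx_curve_deg d.+1 (fun x => stage_mx T' p' x i).
Proof.
move=> a b.
pose h (x : X') := splice i p' (subst_at x i (delta_mx 0 a)).
apply: (@curve_deg_eq _ _ _ _ ((fun x => T' x 0 b) \o h)).
  by move=> x; rewrite /= -(mul_stage_mx T'_lin) -rowE mxE.
apply: (@curve_degW _ _ _ (d.+1 * 1)); first by rewrite muln1.
apply: curve_deg_comp (T'_deg b) => j c.
rewrite /h; case hj : (j < i)%N.
  apply: curve_deg_eq (curve_deg_cst 1 (p' j 0 c)) => x.
  by rewrite ffunE hj.
have [hji|hji] := eqVneq j i.
  apply: curve_deg_eq (curve_deg_cst 1 ((delta_mx 0 a : V') 0 c)) => x.
  by rewrite !ffunE hj hji eqxx.
apply: curve_deg_eq (curve_deg_coord j c) => x.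
by rewrite !ffunE hj (negPf hji).
Qed.

Lemma line_deg_subst_at D (g : X' -> L) x j :
  curve_deg D g -> line_deg D (fun v => g (subst_at x j v)).
Proof.
move=> hg a b.
pose c (l : 'I_d.+1) (k : 'I_n) : {poly L} :=
  if l == j then (a 0 k)%:P + b 0 k *: 'X else (x l 0 k)%:P.
have [|P hP hPg] := hg 1%N c.
  move=> l k; rewrite /c; case: ifP => _; last first.
    exact: leq_trans (size_polyC_leq1 _) _.
  apply: leq_trans (size_polyD _ _) _; rewrite geq_max.
  rewrite (leq_trans (size_polyC_leq1 _)) //=.
  by apply: leq_trans (size_scale_leq _ _) _; rewrite size_polyX.
exists P; first by rewrite -[D]muln1.
move=> s; rewrite hPg; congr g; apply/ffunP => l; apply/rowP => k.
by rewrite !ffunE mxE /c; case: ifP => _; rewrite !hornerE // !mxE mulrC.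
Qed.

Variables (p : X) (r : {ffun 'I_d.+1 -> nat}) (xbar : X').
Local Notation p' := (lift_pt p).
Hypothesis r_max :
  is_colex_max [set rank_tuple T' p' x | x in admissible T' p']%classic r.
Hypothesis xbar_adm : admissible T' p' xbar.
Hypothesis xbar_rank : rank_tuple T' p' xbar = r.

(** The function [g] does not vanish at the points whose coordinates above [k]
    are nonzero multiples of those of [xbar]. *)
Definition nonzero_above (k : nat) (g : X' -> L) : Prop :=
  forall (x : X') (c : 'I_d.+1 -> L), (forall l, c l != 0) ->
    (forall l, (k < l)%N -> x l = c l *: xbar l) -> g x != 0.

(** Above [i], the coordinates of [x] are possible values for the process
    started at [p], and the ranks are those of [r]. *)
Definition on_track (i : 'I_d.+1) (x : X) : bool :=
  [forall l : 'I_d.+1, (i < l)%N ==>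
    (x l *m stage_mx T p x l == 0) && (\rank (stage_mx T p x l) == r l)].

(** Moreover, the rank at [i] is at least [m]. *)
Definition good (i : 'I_d.+1) (m : nat) (x : X) : bool :=
  on_track i x && (m <= \rank (stage_mx T p x i))%N.

Lemma on_trackP i (x : X) : reflect (forall l : 'I_d.+1, (i < l)%N ->
    x l *m stage_mx T p x l = 0 /\ \rank (stage_mx T p x l) = r l)
  (on_track i x).
Proof.
apply: (iffP forallP) => h l.
  by move=> hl; have := h l; rewrite hl => /andP[/eqP-> /eqP->].
by apply/implyP => /h[-> ->]; rewrite !eqxx.
Qed.

Lemma on_track_rank_le i x :
  on_track i x -> (\rank (stage_mx T p x i) <= r i)%N.
Proof.
move=> /on_trackP hx; rewrite -lift_rank; apply: (colex_max_stage T'_lin r_max).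
move=> l /hx[h1 h2]; rewrite lift_rank h2; split=> //.
by rewrite lift_stage_mx ffunE -map_mxM h1 map_mx0.
Qed.

Lemma xbar_stage_rank i : \rank (stage_mx T' p' xbar i) = r i.
Proof. by rewrite -rank_tupleE xbar_rank. Qed.

Variables (i : 'I_d.+1) (m M : nat).
Hypothesis m_le_r : (m <= r i)%N.
Hypothesis m_le : (m <= M)%N.
Hypothesis r_le : forall l : 'I_d.+1, (i < l)%N -> (r l <= M)%N.
(* [e] bounds the degree of the minors and projections of the stage matrices,
   and [rho] the factor by which the degree grows at each stage. *)
Let e := (M.+1 * d.+1)%N.
Let rho := (2 * e)%N.
Hypothesis rho_lt : (rho ^ d < #|F|)%N.
Let delta0 : R := (rho ^ d)%:R / (#|F|.-1)%:R.

Let e_gt0 : (0 < e)%N. Proof. by rewrite /e muln_gt0. Qed.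
Let delta0_ge0 : 0 <= delta0. Proof. by rewrite divr_ge0. Qed.

(** At the stage [i], the function [g] is a minor of size [m] of the stage
    matrix. *)
Lemma good_prob_base : exists g : X' -> L,
  [/\ curve_deg rho g,
      nonzero_above i g &
      forall x, on_track i x -> g (lift_pt x) != 0 ->
        1 <= gibbs T p i.+1 (fun y => (good i m y)%:R : R) x].
Proof.
have [A [B hAB]] : exists (A : 'M[L]_(m, n)) (B : 'M_(n, m)),
    A *m stage_mx T' p' xbar i *m B = 1%:M.
  by apply: rank_ge_minor; rewrite xbar_stage_rank.
exists (fun x => \det (A *m stage_mx T' p' x i *m B)); split.
- apply: curve_degW (curve_deg_minor A B (stage_mx_deg p' i)).
  rewrite /rho /e mul2n -addnn; apply: leq_trans (leq_addr _ _).
  by rewrite leq_mul2r (leqW m_le) orbT.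
- move=> x c hc hx.
  have [a ha ->] := stage_mx_scale T'_lin p' hc hx.
  by rewrite -scalemxAr -scalemxAl detZ hAB det1 mulr1 expf_neq0.
- move=> x /on_trackP hx hg; rewrite -[X in X <= _](gibbs_cst T p i.+1 1 x).
  apply: gibbs_le => // y hy.
  have hst l : (i <= l)%N -> stage_mx T p y l = stage_mx T p x l.
    by move=> hl; apply: eq_stage_mx => l' hl'; rewrite hy ?(leq_ltn_trans hl).
  have -> : good i m y; last by [].
  apply/andP; split.
    by apply/on_trackP => l hl; rewrite (hst l (ltnW hl)) (hy l hl); apply: hx.
  by rewrite hst // -lift_rank; apply: minor_rank_ge hg.
Qed.

(** One more step of the process: the last coordinate is uniform in a kernel,
    on which the function obtained so far vanishes rarely as soon as it does
    not vanish at the image of the coordinate of [xbar] by the polynomial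
    projection onto this kernel. *)
Lemma good_prob_step s j j' : (j = s.+1 + i :> nat)%N -> (j = j'.+1 :> nat) ->
  (exists g : X' -> L,
  [/\ curve_deg (rho ^ s.+1) g,
      nonzero_above j' g &
      forall x, on_track j' x -> g (lift_pt x) != 0 ->
        1 - s%:R * delta0
          <= gibbs T p j'.+1 (fun y => (good i m y)%:R : R) x]) ->
  exists g : X' -> L,
  [/\ curve_deg (rho ^ s.+2) g,
      nonzero_above j g &
      forall x, on_track j x -> g (lift_pt x) != 0 ->
        1 - s.+1%:R * delta0
          <= gibbs T p j.+1 (fun y => (good i m y)%:R : R) x].
Proof.
move=> hj hjj' [g [g_deg g_neq0 g_prob]].
have hij : (i < j)%N by rewrite hj; lia.
have [A [B hAB]] : exists (A : 'M[L]_(r j, n)) (B : 'M_(n, r j)),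
    A *m stage_mx T' p' xbar j *m B = 1%:M.
  by apply: rank_ge_minor; rewrite xbar_stage_rank.
pose St x := stage_mx T' p' x j.
pose Delta x := \det (A *m St x *m B).
pose w x := xbar j *m kernel_proj A B (St x).
(* [Delta] forces the rank at [j], and the other factor gives a point of the
   kernel at which [g] is nonzero. *)
exists (fun x => Delta x * g (subst_at x j (w x))); split.
- have hrj := r_le hij.
  have hE : ((r j).+1 * d.+1 <= e)%N by rewrite leq_mul2r ltnS hrj orbT.
  apply: (@curve_degW _ _ _ (e + rho ^ s.+1 * e)).
    have -> : (rho ^ s.+2 = rho ^ s.+1 * e + rho ^ s.+1 * e)%N.
      by rewrite expnSr -mulnDr addnn -mul2n.
    by rewrite leq_add2r leq_pmull // expn_gt0 /rho muln_gt0 e_gt0.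
  apply: curve_degM.
    apply: curve_degW (curve_deg_minor A B (stage_mx_deg p' j)).
    by apply: leq_trans hE; rewrite leq_mul2r leqnSn orbT.
  apply: (curve_deg_comp (h := fun x => subst_at x j (w x)) _ g_deg) => l a.
  have [hlj|hlj] := eqVneq l j.
    apply: (@curve_deg_eq _ _ _ _ (fun x => w x 0 a)).
      by move=> x; rewrite ffunE hlj eqxx.
    apply: curve_degW hE _; rewrite -[(_ * _)%N]add0n.
    apply: (mx_curve_degM (mx_curve_deg_cst 0 (xbar j))).
    exact: mx_curve_deg_kernel_proj (stage_mx_deg p' j).
  apply: curve_degW e_gt0 _; apply: curve_deg_eq (curve_deg_coord l a) => x.
  by rewrite ffunE (negPf hlj).
- move=> x c hc hx.
  have [a ha hSt] := stage_mx_scale T'_lin p' hc hx.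
  have hD : Delta x != 0.
    rewrite /Delta /St hSt -scalemxAr -scalemxAl detZ hAB det1 mulr1.
    exact: expf_neq0.
  apply: mulf_neq0 => //.
  have hw : w x = Delta x *: xbar j.
    apply: kernel_proj_ker; rewrite /St hSt -scalemxAr.
    have /(admissibleP T'_lin)/(_ j) -> := xbar_adm; first by rewrite scaler0.
    exact: leq_ltn_trans hij.
  apply: (g_neq0 _ (fun l => if l == j then Delta x else c l)).
    by move=> l; case: ifP.
  move=> l hl; rewrite ffunE; case: eqP => [->|hlj]; first by rewrite hw.
  apply: hx; rewrite ltn_neqAle hjj' hl andbT -hjj'.
  by apply: contra_notN hlj => /eqP/val_inj.
- move=> x hx; rewrite mulf_eq0 negb_or => /andP[hD hg].
  set N := stage_mx T p x j.
  have hrank : \rank N = r j.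
    apply/eqP; rewrite eqn_leq on_track_rank_le //= -lift_rank.
    exact: minor_rank_ge hD.
  have hwN : w (lift_pt x) *m map_mx iota N = 0.
    rewrite -lift_stage_mx -mulmxA kernel_projM ?mulmx0 //.
    by rewrite /St lift_rank.
  have hsd : (rho ^ s.+1 <= rho ^ d)%N.
    apply: leq_pexp2l; first by rewrite /rho muln_gt0 e_gt0.
    have := ltn_ord j; rewrite hj ltnS; apply: leq_trans; exact: leq_addr.
  have hsz := schwartz_zippel_ker
    (line_deg_subst_at (lift_pt x) j g_deg)
    (leq_ltn_trans hsd rho_lt) hwN hg.
  set Z := [set v | _ && _] in hsz.
  rewrite [gibbs _ _ _ _ _]/= inord_val -/N.
  (* [Z] consists of the kernel vectors at which [g] vanishes. *)
  pose lo v : R := 1 - s%:R * delta0 - (v \in Z)%:R.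
  apply: (@le_trans _ _ (avg (kerset N) lo)); last first.
    apply: avg_le => v hv; rewrite hjj' /lo.
    case hvZ : (v \in Z).
      apply: (@le_trans _ _ 0).
        by rewrite addrAC subrr add0r oppr_le0 mulr_ge0.
      rewrite -[X in X <= _](gibbs_cst T p j'.+1 0 (subst_at x j v)).
      by apply: gibbs_le.
    rewrite subr0; apply: g_prob; last first.
      rewrite -lift_subst_at; move: hvZ; rewrite inE hv eqxx /=.
      by move/negbT.
    have hSt l : (j <= l)%N ->
        stage_mx T p (subst_at x j v) l = stage_mx T p x l.
      move=> hl; apply: eq_stage_mx => l' hl'; rewrite ffunE.
      by case: eqP => // hl''; move: hl'; rewrite hl'' ltnNge hl.
    apply/on_trackP => l hl; rewrite hSt ?hjj' // ffunE.
    case: eqP => [->|hlj]; first by [].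
    move/on_trackP: hx; apply; rewrite ltn_neqAle hjj' hl andbT -hjj'.
    by apply: contra_notN hlj => /eqP/val_inj.
  have hZ : \sum_(v in kerset N) ((v \in Z)%:R : R) = #|Z|%:R.
    rewrite -natr_sum -big_mkcondr /= sum1_card; congr (_%:R).
    by apply: eq_card => v; rewrite !inE unfold_in /= !inE; case: eqP.
  have hK := kerset_gt0 R N.
  have hlo : \sum_(v in kerset N) lo v
      = (1 - s%:R * delta0) * #|kerset N|%:R - #|Z|%:R.
    by rewrite sumrB hZ sumr_const mulr_natr.
  have hZK : #|Z|%:R <= delta0 * #|kerset N|%:R.
    rewrite /delta0 mulrAC ler_pdivlMr; last first.
      by rewrite ltr0n -ltnS prednK ?(leq_ltn_trans _ rho_lt) //; lia.
    rewrite -!natrM ler_nat; apply: leq_trans hsz _.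
    by rewrite leq_mul2r hsd orbT.
  by rewrite /avg ler_pdivlMr // hlo -natr1; lra.
Qed.

(** At the top coordinate both conditions on the starting point are vacuous: no
    coordinate lies above it, so that [g] vanishes nowhere. *)
Lemma good_prob :
  1 - d%:R * delta0 <= gibbs T p d.+1 (fun y => (good i m y)%:R : R) p.
Proof.
have key s j : (j = s + i :> nat)%N -> exists g : X' -> L,
  [/\ curve_deg (rho ^ s.+1) g, nonzero_above j g &
      forall x, on_track j x -> g (lift_pt x) != 0 ->
        1 - s%:R * delta0
          <= gibbs T p j.+1 (fun y => (good i m y)%:R : R) x].
  elim: s j => [|s IH] j hj.
    have -> : j = i by apply: val_inj.
    by have [g [h1 h2 h3]] := good_prob_base; exists g; rewrite mul0r subr0.
  have hs : (s + i < d.+1)%N.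
    by apply: leq_ltn_trans (ltn_ord j); rewrite hj leq_add2r.
  exact: (@good_prob_step s j (Ordinal hs) hj hj (IH (Ordinal hs) erefl)).
have [|g [_ g_neq0 g_prob]] := key (d - i)%N ord_max.
  by rewrite subnK // -ltnS.
have : 1 - (d - i)%:R * delta0
    <= gibbs T p d.+1 (fun y => (good i m y)%:R : R) p.
  apply: g_prob.
    by apply/on_trackP => l; rewrite ltnNge -ltnS ltn_ord.
  apply: (g_neq0 _ (fun=> 1)) => [l|l]; first exact: oner_neq0.
  by rewrite ltnNge -ltnS ltn_ord.
apply: le_trans; rewrite lerD2l lerN2 ler_wpM2r // ler_nat; exact: leq_subr.
Qed.

End Attain.

Lemma le_weighted_norm D (r : {ffun 'I_D -> nat}) i :
  (r i <= weighted_norm r)%N.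
Proof.
rewrite /weighted_norm (bigD1 i) //=; apply: leq_trans (leq_addr _ _).
by rewrite leq_pmull // expn_gt0.
Qed.

(** * Bounding the algebraic local rank *)

Section MaxAttained.
Variables (R : realType) (F : finFieldType) (L : fieldType).
Variables (iota : {rmorphism F -> L}) (n d : nat).
Local Notation X := {ffun 'I_d.+1 -> 'rV[F]_n}.
Local Notation X' := {ffun 'I_d.+1 -> 'rV[L]_n}.
Variables (T : X -> 'rV[F]_n) (T' : X' -> 'rV[L]_n).
Hypothesis T_lin : multilinear_map T.
Hypothesis T'_lin : multilinear_map T'.
Hypothesis T'_lift : forall x, T' (lift_pt iota x) = map_mx iota (T x).
Hypothesis T'_deg : forall b, curve_deg d.+1 (fun x => T' x 0 b).

(** The bound on the expected norm bounds the entries of the algebraic local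
    rank from the top coordinate down: if an entry were greater than [M], the
    entry of the process would be greater than [M] at least half of the time.
    Once all entries are bounded, the process attains the algebraic local
    rank. *)
Lemma local_rank_attained (p : X) (r : {ffun 'I_d.+1 -> nat}) (B : R)
    (M : nat) :
  let delta : R :=
    d%:R * (((2 * (M.+2 * d.+1)) ^ d)%:R / (#|F|.-1)%:R) in
  is_colex_max [set rank_tuple T' (lift_pt iota p) x
               | x in admissible T' (lift_pt iota p)]%classic r ->
  gibbs T p d.+1 (fun x => (weighted_norm (rank_tuple T p x))%:R) p <= B ->
  2 * B < M.+1%:R ->
  ((2 * (M.+2 * d.+1)) ^ d < #|F|)%N ->
  delta <= 2^-1 ->
  (exists2 x, admissible T p x & rank_tuple T p x = r) /\
  (weighted_norm r)%:R * (1 - delta) <= B.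
Proof.
move=> delta r_max hB hM hF hdelta.
have [[xbar xbar_adm xbar_rank] _] := r_max.
have prob i m (hmr : (m <= r i)%N) (hm : (m <= M.+1)%N)
    (hr : forall l : 'I_d.+1, (i < l)%N -> (r l <= M.+1)%N) :
    1 - delta <= gibbs T p d.+1 (fun y => (good T p r i m y)%:R : R) p.
  exact: (@good_prob R F L iota n d T T' T'_lin T'_lift T'_deg p r xbar
    r_max xbar_adm xbar_rank i m M.+1 hmr hm hr hF).
have bound (i : 'I_d.+1) m (w : nat) :
    1 - delta <= gibbs T p d.+1 (fun y => (good T p r i m y)%:R : R) p ->
    (forall y, good T p r i m y -> (w <= weighted_norm (rank_tuple T p y))%N) ->
    w%:R * (1 - delta) <= B.
  move=> hp hw; apply: le_trans hB.
  apply: le_trans (ler_wpM2l (ler0n R w) hp) _.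
  rewrite -gibbsZ; apply: gibbs_le => // y _; rewrite -natrM ler_nat.
  by case: (boolP (good T p r i m y)) => [/hw|_]; rewrite ?muln1 ?muln0.
have r_le l : (l <= d.+1)%N ->
    forall i : 'I_d.+1, (d.+1 - l <= i)%N -> (r i <= M)%N.
  elim: l => [|l IH] hl i hi; first by have := ltn_ord i; lia.
  have hr (j : 'I_d.+1) : (i < j)%N -> (r j <= M.+1)%N.
    by move=> hj; apply: leqW; apply: IH; lia.
  rewrite leqNgt; apply/negP => hri.
  have h0 : 0 < M.+1%:R :> R by rewrite ltr0n.
  have h1 : M.+1%:R * (1 - delta) <= B.
    apply: (bound i M.+1 _ (prob i M.+1 hri (leqnn _) hr)) => y /andP[_ hy].
    by apply: leq_trans (le_weighted_norm _ i); rewrite rank_tupleE.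
  have : M.+1%:R * 2^-1 <= M.+1%:R * (1 - delta) by rewrite ler_pM2l //; lra.
  lra.
have r_leM i : (r i <= M)%N by apply: (r_le d.+1); rewrite ?subnn.
have p0 := prob ord0 (r ord0) (leqnn _) (leqW (r_leM _))
  (fun l _ => leqW (r_leM l)).
have good_rank y : good T p r ord0 (r ord0) y -> rank_tuple T p y = r.
  move=> /andP[hy hy0]; apply/ffunP => l; rewrite rank_tupleE.
  have [->|hl] := eqVneq l ord0.
    apply/eqP; rewrite eqn_leq hy0 andbT.
    exact: (on_track_rank_le T'_lin T'_lift r_max).
  by move/on_trackP: hy => /(_ l)[]//; move: hl; rewrite lt0n -(inj_eq val_inj).
split; last by apply: bound p0 _ => y /good_rank->.
have [[y hy]|hno] := pselect (exists y, good T p r ord0 (r ord0) y).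
  exists y; last exact: good_rank.
  apply/(admissibleP T_lin) => l hl.
  by case/andP: hy => /on_trackP/(_ l hl)[].
have : 1 - delta <= 0.
  apply: (le_trans p0); rewrite -[X in _ <= X](gibbs_cst T p d.+1 0 p).
  apply: gibbs_le => // y _; case hy: (good _ _ _ _ _ _) => //.
  by case: hno; exists y.
lra.
Qed.

(** The local rank over the small field is attained where the algebraic one
    is. *)
Lemma local_rank_lift p r :
  is_colex_max [set rank_tuple T' (lift_pt iota p) x
               | x in admissible T' (lift_pt iota p)]%classic r ->
  (exists2 x, admissible T p x & rank_tuple T p x = r) ->
  local_rank T p = r /\ local_rank T' (lift_pt iota p) = r.
Proof.
move=> r_max hr; split.
  have hmax :
      is_colex_max [set rank_tuple T p x | x in admissible T p]%classic r.
    split=> // s [y hy <-]; apply: r_max.2.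
    rewrite -(lift_rank_tuple T'_lift); apply: imageP.
    exact: lift_admissible T'_lift _ _ hy.
  apply: (colex_max_unique _ hmax); apply: xgetPex.
  by exists r.
by apply: (colex_max_unique _ r_max); apply: xgetPex; exists r.
Qed.

Lemma alg_rank_max_exists (p : X) : exists r,
  is_colex_max [set rank_tuple T' (lift_pt iota p) x
               | x in admissible T' (lift_pt iota p)]%classic r.
Proof.
apply: (@colex_max_exists _ n _ (rank_tuple T' (lift_pt iota p) [ffun=> 0])).
  apply: imageP; apply/(admissibleP T'_lin) => i _.
  by rewrite ffunE mul0mx.
by move=> _ [x _ <-] i; rewrite rank_tupleE rank_leq_row.
Qed.

End MaxAttained.

(** * Extension of scalars *)

(** A scalar function with a proof of linearity, as a bundled linear form. *)
Definition as_scalar (F : fieldType) (m : nat) (f : 'rV[F]_m -> F)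
    (hf : scalar f) : {scalar 'rV[F]_m} :=
  HB.pack f (GRing.isLinear.Build F 'rV[F]_m F *%R f hf).

Section BaseChange.
Variables (F L : fieldType) (iota : {rmorphism F -> L}) (n k : nat).

Lemma multilinear_expand (E : fieldType) (t : {ffun 'I_k -> 'rV[E]_n} -> E)
    x i v :
  multilinear t ->
  t (subst_at x i v) = \sum_a v 0 a * t (subst_at x i (delta_mx 0 a)).
Proof.
move=> ht; rewrite {1}(row_sum_delta v).
rewrite -[LHS]/(as_scalar (ht x i) _) linear_sum; apply: eq_bigr => a _.
by rewrite linearZ.
Qed.

(** A function which is linear in each variable is determined by its values on
    the standard basis vectors. *)
Lemma eq_on_basis (f g : {ffun 'I_k -> 'rV[F]_n} -> L) :
  (forall x i v, f (subst_at x i v)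
     = \sum_a iota (v 0 a) * f (subst_at x i (delta_mx 0 a))) ->
  (forall x i v, g (subst_at x i v)
     = \sum_a iota (v 0 a) * g (subst_at x i (delta_mx 0 a))) ->
  (forall j : {ffun 'I_k -> 'I_n},
     f [ffun i => delta_mx 0 (j i)] = g [ffun i => delta_mx 0 (j i)]) ->
  f =1 g.
Proof.
move=> hf hg hfg.
have key l : (l <= k)%N -> forall x : {ffun 'I_k -> 'rV[F]_n},
    (forall i : 'I_k, (l <= i)%N -> exists a, x i = delta_mx 0 a) -> f x = g x.
  elim: l => [|l IH] hl x hx.
    have /fin_all_exists[j hj] : forall i, exists a, x i = delta_mx 0 a.
      by move=> i; apply: hx.
    have -> : x = [ffun i => delta_mx 0 ([ffun i => j i] i)].
      by apply/ffunP => i; rewrite !ffunE hj.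
    exact: hfg.
  pose i0 := Ordinal hl; rewrite -(subst_at_same x i0) hf hg.
  apply: eq_bigr => a _; congr (_ * _); apply: IH; first exact: ltnW.
  move=> i hi; rewrite ffunE; case: eqP => [_|hne]; first by exists a.
  apply: hx; rewrite ltn_neqAle hi andbT.
  by apply: contra_notN hne => /eqP hh; apply: val_inj.
by move=> x; apply: (key k) => // i; rewrite leqNgt ltn_ord.
Qed.

Variable t : {ffun 'I_k -> 'rV[F]_n} -> F.

Lemma base_change_multilinear : multilinear (base_change iota t).
Proof.
move=> x i a u v; rewrite /base_change mulr_sumr -big_split.
apply: eq_bigr => j _ /=; rewrite mulrCA -mulrDr; congr (_ * _).
rewrite !(bigD1 (P := xpredT) i) //= !ffunE eqxx.
have hsub w : \prod_(i' < k | i' != i) subst_at x i w i' 0 (j i')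
    = \prod_(i' < k | i' != i) x i' 0 (j i').
  by apply: eq_bigr => i' /negPf hi'; rewrite ffunE hi'.
by rewrite !hsub !mxE mulrDl mulrA.
Qed.

Lemma base_change_lift (x : {ffun 'I_k -> 'rV[F]_n}) : multilinear t ->
  base_change iota t [ffun i => map_mx iota (x i)] = iota (t x).
Proof.
move=> ht; move: x; apply: eq_on_basis => [x i v|x i v|j].
- have hs w : [ffun i' => map_mx iota (subst_at x i w i')]
      = subst_at [ffun i' => map_mx iota (x i')] i (map_mx iota w).
    by apply/ffunP => i'; rewrite !ffunE; case: eqP.
  rewrite hs (multilinear_expand _ _ _ base_change_multilinear).
  by apply: eq_bigr => a _; rewrite hs map_delta_mx mxE.
- rewrite multilinear_expand // rmorph_sum; apply: eq_bigr => a _.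
  by rewrite rmorphM.
rewrite /base_change (bigD1 j) //= big1 ?mulr1 ?addr0 => [|i _]; last first.
  by rewrite !ffunE !mxE !eqxx rmorph1.
rewrite big1 ?addr0 ?mulr1 // => j' hj'.
have [i hi] : exists i, j' i != j i.
  apply/existsP; apply: contraNT hj'; rewrite negb_exists => /forallP h.
  by apply/eqP/ffunP => i; have := h i; rewrite negbK => /eqP.
rewrite (bigD1 i) //= !ffunE !mxE (negPf hi) andbF rmorph0.
by rewrite mul0r mulr0.
Qed.

End BaseChange.

Lemma append_last_subst_at (V : Type) k (x : {ffun 'I_k.-1 -> V}) i v w :
  append_last (subst_at x i v) w
  = subst_at (append_last x w) (widen_ord (leq_pred k) i) v.
Proof.
apply/ffunP => j; rewrite !ffunE; case: insubP => [j' hj hj'|hj].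
  rewrite ffunE -!(inj_eq val_inj) /= hj' //.
case: eqP => // hji; move: hj.
by rewrite hji /= ltn_ord.
Qed.

Lemma dlin_map_multilinear (F : fieldType) n k
    (t : {ffun 'I_k -> 'rV[F]_n} -> F) :
  multilinear t -> multilinear_map (dlin_map t).
Proof.
move=> ht x i a u v; apply/rowP => j; rewrite !mxE !append_last_subst_at.
exact: ht.
Qed.

Section DlinMapBaseChange.
Variables (F : finFieldType) (L : fieldType).
Variables (iota : {rmorphism F -> L}) (n d : nat).
Variable t : {ffun 'I_d.+2 -> 'rV[F]_n} -> F.

Lemma dlin_map_lift (x : {ffun 'I_d.+1 -> 'rV[F]_n}) : multilinear t ->
  dlin_map (base_change iota t) (lift_pt iota x : {ffun 'I_d.+2.-1 -> _})
  = map_mx iota (dlin_map t x).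
Proof.
move=> ht; apply/rowP => b; rewrite !mxE -base_change_lift //.
congr base_change.
apply/ffunP => i; rewrite !ffunE; case: insubP => [j _ _|_].
  by rewrite ffunE.
by rewrite map_delta_mx.
Qed.

Lemma dlin_map_deg b : @curve_deg L d.+1 n d.+1
  (fun x => dlin_map (base_change iota t) (x : {ffun 'I_d.+2.-1 -> _}) 0 b).
Proof.
apply: (@curve_deg_eq _ _ _ _ (fun x : {ffun 'I_d.+1 -> 'rV[L]_n} =>
  \sum_(j <- enum {ffun 'I_d.+2 -> 'I_n})
    (iota (t [ffun i => delta_mx 0 (j i)])
     * (delta_mx 0 b : 'rV[L]_n) 0 (j ord_max))
    * \prod_(i <- enum 'I_d.+1) x i 0 (j (widen_ord (leqnSn _) i)))).
  move=> x; rewrite mxE /base_change big_enum; apply: eq_bigr => j _.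
  rewrite big_ord_recr /= big_enum /= -mulrA; congr (_ * _).
  rewrite mulrC; congr (_ * _).
    apply: eq_bigr => i _; rewrite ffunE; case: insubP => [i' _ hi'|].
      by congr (x _ _ _); apply: val_inj.
    by rewrite /= ltn_ord.
  by rewrite ffunE insubF //= ltnn.
apply: curve_deg_sum => j; apply: curve_degZ.
apply: (@curve_degW _ _ _ (size (enum 'I_d.+1) * 1)).
  by rewrite size_enum_ord muln1.
by apply: curve_deg_prod => i; apply: curve_deg_coord.
Qed.

End DlinMapBaseChange.

(** * A point with a small expected norm *)

Lemma sum_pow2 D : (\sum_(i < D) 2 ^ (D - i.+1) = 2 ^ D - 1)%N.
Proof.
rewrite subn1 predn_exp mul1n (reindex_inj rev_ord_inj) /=.
by apply: eq_bigr => i _; rewrite subnSK ?subKn // ltnW.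
Qed.

Section ChoosePoint.
Variables (R : realType) (F : finFieldType) (n d : nat).
Local Notation X := {ffun 'I_d.+1 -> 'rV[F]_n}.
Variable T : X -> 'rV[F]_n.
Hypothesis T_lin : multilinear_map T.
Let AR : R := - (ln (#|zeros T|%:R / #|{: X}|%:R) / ln #|F|%:R).

Lemma analytic_rank_ge0 : 0 <= AR.
Proof.
have h := sum_rank_le R T_lin ord0.
rewrite -(pmulr_rge0 _ (_ : 0 < #|zeros T|%:R)) ?ltr0n ?zeros_neq0 //.
by apply: le_trans h; apply: sumr_ge0.
Qed.

Lemma small_expected_norm : exists p : X,
  gibbs T p d.+1 (fun x => (weighted_norm (rank_tuple T p x))%:R) p
    <= (2 ^+ d.+1 - 1) * AR.
Proof.
pose phi (p : X) : R :=
  gibbs T p d.+1 (fun x => (weighted_norm (rank_tuple T p x))%:R) p.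
have hphi p : phi p = \sum_(i < d.+1) (2 ^ (d.+1 - i.+1))%:R
    * gibbs T p d.+1 (fun x => (\rank (partial_mx T (splice i.+1 p x) i))%:R) p.
  rewrite -gibbs_sum /phi; congr gibbs; apply/funext => x.
  rewrite natr_sum; apply: eq_bigr => i _.
  by rewrite natrM rank_tupleE.
have hsum : \sum_(p in zeros T) phi p
    <= #|zeros T|%:R * ((2 ^+ d.+1 - 1) * AR).
  under eq_bigr do rewrite hphi.
  rewrite exchange_big /=.
  have -> : 2 ^+ d.+1 - 1 = \sum_(i < d.+1) (2 ^ (d.+1 - i.+1))%:R :> R.
    by rewrite -natr_sum sum_pow2 natrB ?expn_gt0 // natrX.
  rewrite mulr_suml mulr_sumr; apply: ler_sum => i _.
  rewrite -mulr_sumr (sum_gibbs_splice T_lin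
    (fun y => (\rank (partial_mx T y i))%:R)) // mulrCA.
  by apply: ler_wpM2l => //; apply: sum_rank_le.
apply: contrapT => /forallNP hno.
have : \sum_(p in zeros T) phi p > \sum_(p in zeros T) ((2 ^+ d.+1 - 1) * AR).
  have [p0 hp0] : exists p0, p0 \in zeros T.
    by apply/card_gt0P; apply: zeros_neq0.
  apply: ltr_sum; first by apply/hasP; exists p0; rewrite ?mem_index_enum.
  by move=> p _; rewrite ltNge; apply/negP/hno.
by rewrite sumr_const -[_ *+ #|_|]mulr_natl ltNge hsum.
Qed.

End ChoosePoint.

(** * The size of the field *)

(** The numerical choices: [M] will bound the entries of the algebraic local
    rank, and [delta] the probability that the process misses it. *)
Lemma field_size_bounds (R : realType) (d q : nat) (A eps : R) :
  let D := d.+1 in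
  let c : R := 4 * D%:R * 2 ^+ D in
  let C : R := 2 * D%:R * 2 ^+ D * c ^+ d in
  0 <= A -> 0 < eps <= 1 -> (1 < q)%N ->
  C * (A + 1) ^+ d / eps <= q%:R ->
  exists M : nat,
    let rho := (2 * (M.+2 * D))%N in
    let delta : R := d%:R * ((rho ^ d)%:R / q.-1%:R) in
    [/\ 2 * ((2 ^+ D - 1) * A) < M.+1%:R, (rho ^ d < q)%N, delta <= 2^-1 &
        delta * 2 ^+ D <= eps].
Proof.
move=> D c C A0 /andP[eps0 eps1] q1 hq.
pose P : R := 2 ^+ D.
have P2 : 2 <= P by rewrite /P exprS ler_peMr // exprn_ege1 //; lra.
have D1 : 1 <= D%:R :> R by rewrite ler1n.
have B0 : 0 <= 2 * ((P - 1) * A) by rewrite !mulr_ge0 //; lra.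
exists (Num.trunc (2 * ((P - 1) * A))); set M := Num.trunc _ => rho delta.
have [hM1 hM2] := andP (truncn_itv B0); rewrite -/M in hM1 hM2.
have c0 : 0 < c by rewrite /c !mulr_gt0 ?exprn_gt0 //; lra.
have hrho : rho%:R <= c * (A + 1).
  have hM3 : M.+2%:R <= 2 * P * (A + 1).
    by rewrite -addn2 natrD; nra.
  rewrite /rho /c -/P !natrM.
  have := ler_wpM2l (ler0n R (2 * D)) hM3; rewrite natrM; lra.
have hrhod : (rho ^ d)%:R <= c ^+ d * (A + 1) ^+ d.
  by rewrite natrX -exprMn lerXn2r // nnegrE ?ler0n // mulr_ge0 //; lra.
have q0 : 0 < q%:R :> R by rewrite ltr0n ltnW.
have hbig : 2 * D%:R * P * (rho ^ d)%:R <= eps * q%:R.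
  rewrite ler_pdivrMr // in hq; rewrite [eps * _]mulrC.
  apply: le_trans hq; rewrite /C -/P -[X in _ <= X]mulrA.
  by apply: ler_wpM2l hrhod; rewrite !mulr_ge0 //; lra.
have rhod0 : 0 <= (rho ^ d)%:R :> R by [].
have hq1 : q%:R <= 2 * q.-1%:R :> R by rewrite -natrM ler_nat; clear -q1; lia.
have q10 : 0 < q.-1%:R :> R by rewrite ltr0n; clear -q1; lia.
have dD : d%:R <= D%:R :> R by rewrite ler_nat.
have d0 : 0 <= d%:R :> R by [].
have hdelta : delta * P <= eps.
  rewrite /delta mulrA mulrAC ler_pdivrMr //.
  have h1 : d%:R * (rho ^ d)%:R * P <= D%:R * P * (rho ^ d)%:R.
    by rewrite [X in _ <= X]mulrAC !ler_wpM2r //; lra.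
  have h2 : eps * q%:R <= eps * (2 * q.-1%:R) by rewrite ler_pM2l.
  lra.
have delta0 : 0 <= delta by rewrite /delta mulr_ge0 // divr_ge0.
split => //.
- rewrite -(ltr_nat R).
  have h1 : 2 * (rho ^ d)%:R <= 2 * D%:R * P * (rho ^ d)%:R.
    apply: ler_wpM2r => //; nra.
  have h2 : eps * q%:R <= 1 * q%:R by apply: ler_wpM2r => //; lra.
  lra.
- have : delta * 2 <= delta * P by apply: ler_wpM2l.
  lra.
Qed.

Theorem mainTheorem5 (R : realType) (k : nat) (hk : (2 <= k)%N) :
  exists2 C : R, 0 < C &
  forall (eps : R) (F : finFieldType) (n : nat)
    (t : {ffun 'I_k -> 'rV[F]_n} -> F),
    0 < eps <= 1 ->
    multilinear t ->
    C * (analytic_rank R t + 1) ^+ (k - 2) / eps <= #|F|%:R ->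
    exists2 p : {ffun 'I_k.-1 -> 'rV[F]_n},
      LR_stable t p &
      (weighted_norm (local_rank (dlin_map t) p))%:R
        <= (2 ^+ (k - 1) - 1 + eps) * analytic_rank R t.
Proof.
case: k hk => [|[|d]] // _; rewrite subn2 subn1 /=.
pose c : R := 4 * d.+1%:R * 2 ^+ d.+1.
exists (2 * d.+1%:R * 2 ^+ d.+1 * c ^+ d).
  by rewrite /c !mulr_gt0 ?exprn_gt0 ?mulr_gt0 ?exprn_gt0 ?ltr0n.
move=> eps F n t heps ht hq.
pose T : {ffun 'I_d.+1 -> 'rV[F]_n} -> 'rV[F]_n := dlin_map t.
have T_lin : multilinear_map T := dlin_map_multilinear ht.
have hA : analytic_rank R t
    = - (ln (#|zeros T|%:R / #|{: {ffun 'I_d.+1 -> 'rV[F]_n}}|%:R)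
         / ln #|F|%:R).
  by rewrite /analytic_rank card_ffun card_ord.
have A0 : 0 <= analytic_rank R t by rewrite hA; apply: analytic_rank_ge0.
have [M [hM hrho hdelta hdelta2]] :=
  field_size_bounds A0 heps (finalg.card_finNzRing_gt1 F) hq.
have [p hp] := small_expected_norm R T_lin; rewrite -hA in hp.
pose iota := to_alg_closure F.
pose T' : {ffun 'I_d.+1 -> 'rV[alg_closure F]_n} -> 'rV_n :=
  dlin_map (base_change iota t).
have T'_lin : multilinear_map T'.
  exact: dlin_map_multilinear (base_change_multilinear iota t).
have T'_lift x : T' (lift_pt iota x) = map_mx iota (T x).
  exact: dlin_map_lift.
have T'_deg b : curve_deg d.+1 (fun x => T' x 0 b) := dlin_map_deg iota t b.
have [r r_max] := alg_rank_max_exists iota T'_lin p.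
have [hx hr] :=
  local_rank_attained T_lin T'_lin T'_lift T'_deg r_max hp hM hrho hdelta.
have [hF hL] := local_rank_lift T'_lift r_max hx.
exists p; first by rewrite /LR_stable -/T hF; symmetry; exact: hL.
rewrite -/T hF; move: hr hdelta hdelta2; set delta := (d%:R * _ : R).
move=> hr hdelta hdelta2.
have P1 : 1 <= 2 ^+ d.+1 :> R by rewrite exprn_ege1 //; lra.
have [eps0 eps1] := andP heps.
have delta0 : 0 <= delta by rewrite /delta mulr_ge0 // divr_ge0.
have hpos : 0 < 1 - delta by lra.
rewrite -(ler_pM2r hpos); apply: le_trans hr _; rewrite mulrAC.
apply: ler_wpM2r => //.
have : delta * eps <= delta by rewrite ler_piMr.
lra.
Qed.
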